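(* Let $A\in\mathbb{R}^{m\times n}$, $b\in\mathbb{R}^m$ with $Ax=b$ consistent, and let $(\Omega,\mathcal{F},\mathbf{P})$ be a probability space of matrices $S\in\mathbb{R}^{m\times q}$ such that $\mathbb{E}[SS^\top]$ is positive definite. Let $H=\mathbb{E}\big[\frac{SS^\top}{\|S^\top A\|_2^2}\big]$ (with the convention $\frac00=0$), and let $\{x^k\}_{k\ge0}$ be generated by the RIM-AS algorithm described in the context. Then for each $k$, $$\mathbb{E}_{S_k\in\Omega}\big[\|x^{k+1}-A^\dagger b\|_2^2\mid x^k\big]\le\big(1-q_k\,\sigma_{\min}^2(H^{1/2}A)\big)\,\|x^k-A^\dagger b\|_2^2,$$ where $q_k$ is defined in the context.
   Context: $A^\dagger$ is the Moore–Penrose pseudoinverse; $\sigma_{\min}(B)$ is the smallest nonzero singular value of $B$; $V^\dagger$ is the pseudoinverse of $V$. RIM-AS algorithm: fix a positive integer $\ell$ and $x^0\in\operatorname{Range}(A^\top)$. For $k=0,1,2,\dots$: (1) randomly draw $S_k\in\Omega$ according to $\mathbf{P}$ (redrawing until $S_k^\top(Ax^k-b)\neq0$); (2) set $j_k=\max\{k-\ell+1,0\}$ and $M_k=(x^{j_k}-x^k,\dots,x^{k-1}-x^k,-A^\top S_kS_k^\top(Ax^k-b))\in\mathbb{R}^{n\times(k-j_k+1)}$; (3) set $\gamma_k=\|S_k^\top(Ax^k-b)\|_2^2$ and let $s_k$ solve $M_k^\top M_ks_k=\gamma_k e$, where $e$ is the last standard unit vector of $\mathbb{R}^{k-j_k+1}$;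 (4) set $x^{k+1}=x^k+M_ks_k$. (Equivalently, $x^{k+1}$ is the orthogonal projection of $A^\dagger b$ onto $x^k+\operatorname{Range}(M_k)$.) Define $V_0=\emptyset$ (so $V_0V_0^\dagger=0$) and $V_k=(x^{j_k}-x^k,\dots,x^{k-1}-x^k)$ for $k\ge1$, $d_k=-A^\top S_kS_k^\top(Ax^k-b)$, $\mathcal{Q}_k=\{S\in\Omega: S^\top(Ax^k-b)\neq0\}$, and $$q_k=\inf_{S_k\in\mathcal{Q}_k}\Big(1-\frac{\|V_kV_k^\dagger d_k\|_2^2}{\|d_k\|_2^2}\Big)^{-1}\ (\ge1).$$ The expectation is over the random choice of $S_k$ given $x^k$. *)

(* Defs.v *)
From HB Require Import structures.
From mathcomp Require Import all_boot all_order all_algebra.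
From mathcomp Require Import all_classical all_reals all_analysis.
Set Implicit Arguments. Unset Strict Implicit. Unset Printing Implicit Defensive.
Import Order.TTheory GRing.Theory Num.Theory.
Local Open Scope classical_set_scope.
Local Open Scope ring_scope.

Section RIMAS.
Variable R : realType.

Definition nrm2 {n} (v : 'cV[R]_n) : R := \sum_i (v i 0) ^+ 2.

Definition opnorm {m n} (M : 'M[R]_(m, n)) : R :=
  sup [set Num.sqrt (nrm2 (M *m v)) | v in [set v : 'cV[R]_n | nrm2 v <= 1]].

(* Moore--Penrose conditions and pseudoinverse (exists and is unique) *)
Definition penrose {m n} (A : 'M[R]_(m, n)) (X : 'M[R]_(n, m)) : Prop :=
  [/\ A *m X *m A = A, X *m A *m X = X,
      (A *m X)^T = A *m X & (X *m A)^T = X *m A].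

Definition pinv {m n} (A : 'M[R]_(m, n)) : 'M[R]_(n, m) :=
  match pselect (exists X, penrose A X) with
  | left h => projT1 (cid h)
  | right _ => 0
  end.

Definition posdef {m} (M : 'M[R]_m) : Prop :=
  M^T = M /\ forall v : 'cV[R]_m, v != 0 -> 0 < (v^T *m M *m v) 0 0.
Definition psd {m} (M : 'M[R]_m) : Prop :=
  M^T = M /\ forall v : 'cV[R]_m, 0 <= (v^T *m M *m v) 0 0.

Definition sqrtmx {m} (H : 'M[R]_m) : 'M[R]_m :=
  match pselect (exists X, psd X /\ X *m X = H) with
  | left h => projT1 (cid h)
  | right _ => 0
  end.

Definition sigma_min {m n} (B : 'M[R]_(m, n)) : R :=
  inf [set Num.sqrt l | l in [set l : R | 0 < l /\ eigenvalue (B^T *m B) l]].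

Definition Emx {d} {T : measurableType d} (P : probability T R) {m n}
  (F : T -> 'M[R]_(m, n)) : 'M[R]_(m, n) :=
  \matrix_(i, j) fine (\int[P]_w (F w i j)%:E).

Definition mx_integrable {d} {T : measurableType d} (P : probability T R) {m n}
  (F : T -> 'M[R]_(m, n)) : Prop :=
  forall i j, P.-integrable setT (fun w => (F w i j)%:E).

Definition cond_expect {d} {T : measurableType d} (P : probability T R)
  (Q : set T) (f : T -> R) : \bar R :=
  ((fine (P Q))^-1)%:E * \int[P]_(w in Q) (f w)%:E.

Section Alg.
Variables (m n q : nat) (l : nat) (A : 'M[R]_(m, n)) (b : 'cV[R]_m).

Definition xstar : 'cV[R]_n := pinv A *m b.

(* j_k = max(k - l + 1, 0) *)
Definition jk (k : nat) : nat := (k.+1 - l)%N.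

(* h = [:: x^0; ...; x^k]; number of columns of V_k is k - j_k *)
Definition ncols (h : seq 'cV[R]_n) : nat := ((size h).-1 - jk (size h).-1)%N.

Definition Vk (h : seq 'cV[R]_n) : 'M[R]_(n, ncols h) :=
  \matrix_(i, c) (nth 0 h (jk (size h).-1 + c) - nth 0 h (size h).-1) i 0.

Definition dk (xk : 'cV[R]_n) (S : 'M[R]_(m, q)) : 'cV[R]_n :=
  - (A^T *m (S *m (S^T *m (A *m xk - b)))).

Definition gammak (xk : 'cV[R]_n) (S : 'M[R]_(m, q)) : R :=
  nrm2 (S^T *m (A *m xk - b)).

(* one step: x^{k+1} = x^k + M_k s_k, with s_k solving
   M_k^T M_k s_k = gamma_k e  (the minimum-norm solution) *)
Definition step (h : seq 'cV[R]_n) (S : 'M[R]_(m, q)) : 'cV[R]_n :=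
  let xk := nth 0 h (size h).-1 in
  let M := row_mx (Vk h) (dk xk S) in
  let e : 'cV[R]_(ncols h + 1) := delta_mx (rshift (ncols h) (ord0 : 'I_1)) ord0 in
  let s := pinv (M^T *m M) *m (gammak xk S *: e) in
  xk + M *m s.

Fixpoint hist (x0 : 'cV[R]_n) (Ss : nat -> 'M[R]_(m, q)) (k : nat)
  : seq 'cV[R]_n :=
  match k with
  | 0 => [:: x0]
  | k'.+1 => let h := hist x0 Ss k' in rcons h (step h (Ss k'))
  end.

Definition rim_iter (x0 : 'cV[R]_n) (Ss : nat -> 'M[R]_(m, q)) (k : nat) : 'cV[R]_n :=
  nth 0 (hist x0 Ss k) k.

Definition Qk {T} (S : T -> 'M[R]_(m, q)) (xk : 'cV[R]_n) : set T :=
  [set w | (S w)^T *m (A *m xk - b) != 0].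

Definition qk {T} (S : T -> 'M[R]_(m, q)) (h : seq 'cV[R]_n) : R :=
  let xk := nth 0 h (size h).-1 in
  inf [set (1 - nrm2 (Vk h *m pinv (Vk h) *m dk xk (S w))
                 / nrm2 (dk xk (S w)))^-1 | w in Qk S xk].

End Alg.
End RIMAS.

(* Main.v *)
(* Put u = xs - x^k. Each iterate is the projection of xs onto an affine space
   containing the next window, so u is orthogonal to Range V_k. Hence the step
   removes from |u|^2 at least gamma_k^2 / |d'|^2, where d' is the component of
   d_k orthogonal to Range V_k, and this equals
   (1 - |V V^+ d|^2 / |d|^2)^-1 * gamma_k^2 / |d|^2. With
   |d|^2 <= |S^T A|^2 gamma_k the decrease is at least q_k r^T Hf(S) r,
   r = A x^k - b. This quadratic form vanishes off Q_k, so integrating over Q_k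
   gives q_k r^T H r >= q_k sigma_min^2 |u|^2, because u lies in Range A^T and
   the smallest nonzero eigenvalue of A^T H A bounds the Rayleigh quotient there;
   the division by P(Q_k) <= 1 only helps. *)
Require Import Defs.
From HB Require Import structures.
From mathcomp Require Import all_boot all_order all_algebra.
From mathcomp Require Import all_classical all_reals all_analysis.
From mathcomp Require Import ring lra zify.
Set Implicit Arguments. Unset Strict Implicit. Unset Printing Implicit Defensive.
Import Order.TTheory GRing.Theory Num.Theory.
Local Open Scope classical_set_scope.
Local Open Scope ring_scope.

(** * Euclidean inner product, Cauchy-Schwarz and operator norm bounds *)

Definition dotv {R : realType} {n} (u v : 'cV[R]_n) : R := (u^T *m v) 0 0.

Section InnerProduct.
Context {R : realType}.

Lemma dotvE n (u v : 'cV[R]_n) : dotv u v = \sum_i u i 0 * v i 0.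
Proof. by rewrite /dotv mxE; apply: eq_bigr => i _; rewrite mxE. Qed.

Lemma nrm2E n (v : 'cV[R]_n) : nrm2 v = dotv v v.
Proof. by rewrite dotvE; apply: eq_bigr => i _; rewrite expr2. Qed.

Lemma dotvC n (u v : 'cV[R]_n) : dotv u v = dotv v u.
Proof. by rewrite !dotvE; apply: eq_bigr => i _; rewrite mulrC. Qed.

Lemma dotvDr n (u v w : 'cV[R]_n) : dotv u (v + w) = dotv u v + dotv u w.
Proof. by rewrite /dotv mulmxDr mxE. Qed.

Lemma dotvDl n (u v w : 'cV[R]_n) : dotv (v + w) u = dotv v u + dotv w u.
Proof. by rewrite !(dotvC _ u) dotvDr. Qed.

Lemma dotvZr n a (u v : 'cV[R]_n) : dotv u (a *: v) = a * dotv u v.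
Proof. by rewrite /dotv -scalemxAr mxE. Qed.

Lemma dotvZl n a (u v : 'cV[R]_n) : dotv (a *: u) v = a * dotv u v.
Proof. by rewrite dotvC dotvZr dotvC. Qed.

Lemma dotvNr n (u v : 'cV[R]_n) : dotv u (- v) = - dotv u v.
Proof. by rewrite -scaleN1r dotvZr mulN1r. Qed.

Lemma dotvNl n (u v : 'cV[R]_n) : dotv (- u) v = - dotv u v.
Proof. by rewrite dotvC dotvNr dotvC. Qed.

Lemma dotv0 n (u : 'cV[R]_n) : dotv u 0 = 0.
Proof. by rewrite /dotv mulmx0 mxE. Qed.

Lemma dot0v n (u : 'cV[R]_n) : dotv 0 u = 0.
Proof. by rewrite dotvC dotv0. Qed.

Lemma dotv_mulmx m n (M : 'M[R]_(m, n)) u v :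
  dotv u (M *m v) = dotv (M^T *m u) v.
Proof. by rewrite /dotv trmx_mul trmxK mulmxA. Qed.

Definition dotvS := (dotvDr, dotvDl, dotvNr, dotvNl, dotvZr, dotvZl).

Lemma nrm2_ge0 n (v : 'cV[R]_n) : 0 <= nrm2 v.
Proof. by apply: sumr_ge0 => i _; exact: sqr_ge0. Qed.

Lemma nrm2_eq0 n (v : 'cV[R]_n) : (nrm2 v == 0) = (v == 0).
Proof.
apply/idP/eqP => [|->]; last by rewrite nrm2E dotv0.
rewrite psumr_eq0 => [/allP h|i _]; last exact: sqr_ge0.
apply/colP => i; rewrite mxE.
by have := h i (mem_index_enum i); rewrite /= sqrf_eq0 => /eqP.
Qed.

Lemma nrm2_gt0 n (v : 'cV[R]_n) : (0 < nrm2 v) = (v != 0).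
Proof. by rewrite lt_def nrm2_ge0 andbT nrm2_eq0. Qed.

Lemma nrm2D_orth n (u v : 'cV[R]_n) : dotv u v = 0 ->
  nrm2 (u + v) = nrm2 u + nrm2 v.
Proof. by move=> h; rewrite !nrm2E !dotvS (dotvC v) h; ring. Qed.

(** The form of [K] at [u + t v] is nonnegative for every [t]; evaluating it at its minimiser in [t]
    gives the discriminant inequality. *)
Lemma psd_cauchy n (K : 'M[R]_n) (u v : 'cV[R]_n) : psd K ->
  dotv u (K *m v) ^+ 2 <= dotv u (K *m u) * dotv v (K *m v).
Proof.
case=> Ksym Kge0.
have form t : 0 <= dotv u (K *m u) + t * dotv u (K *m v) *+ 2
                   + t ^+ 2 * dotv v (K *m v).
  have := Kge0 (u + t *: v); rewrite -mulmxA -/(dotv _ _).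
  rewrite mulmxDr -scalemxAr !dotvS.
  rewrite [dotv v (K *m u)]dotv_mulmx Ksym (dotvC (K *m v)).
  by move=> h; rewrite (le_trans h)// le_eqVlt; apply/orP; left; apply/eqP; ring.
have a0 := form 0; have c0 : 0 <= dotv v (K *m v).
  by have := Kge0 v; rewrite -mulmxA.
move: c0; rewrite le_eqVlt => /orP[/eqP c0|c0].
  have [->|b0] := eqVneq (dotv u (K *m v)) 0; first by rewrite -c0; lra.
  (* Without a quadratic term the form is affine in [t], and this [t] would give it the value -1. *)
  have := form (- (dotv u (K *m u) + 1) / (dotv u (K *m v) *+ 2)).
  rewrite -c0 mulr0 addr0 -mulr_natr.
  have -> : - (dotv u (K *m u) + 1) / (dotv u (K *m v) *+ 2) *
     dotv u (K *m v) * 2%:R = - (dotv u (K *m u) + 1) by field.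
  lra.
have := form (- dotv u (K *m v) / dotv v (K *m v)).
have -> : dotv u (K *m u) + - dotv u (K *m v) / dotv v (K *m v)
     * dotv u (K *m v) *+ 2 + (- dotv u (K *m v) / dotv v (K *m v)) ^+ 2
     * dotv v (K *m v) = (dotv u (K *m u) * dotv v (K *m v)
        - dotv u (K *m v) ^+ 2) / dotv v (K *m v).
  by field; rewrite gt_eqF.
by rewrite pmulr_lge0 ?invr_gt0// subr_ge0.
Qed.

Lemma dotv_cauchy n (u v : 'cV[R]_n) : dotv u v ^+ 2 <= nrm2 u * nrm2 v.
Proof.
have := @psd_cauchy _ 1%:M u v; rewrite !mul1mx -!nrm2E; apply.
split; first exact: trmx1.
by move=> w; rewrite mulmx1 -/(dotv w w) -nrm2E nrm2_ge0.
Qed.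

(** Cauchy-Schwarz on each row; the constant is the squared Frobenius norm of [M]. *)
Lemma nrm2_mulmx_bounded m n (M : 'M[R]_(m, n)) :
  exists2 C, 0 <= C & forall v, nrm2 (M *m v) <= C * nrm2 v.
Proof.
exists (\sum_i nrm2 (row i M)^T).
  by apply: sumr_ge0 => i _; exact: nrm2_ge0.
move=> v; rewrite mulr_suml; apply: ler_sum => i _.
have -> : (M *m v) i 0 = dotv (row i M)^T v.
  by rewrite dotvE mxE; apply: eq_bigr => j _; rewrite !mxE.
exact: dotv_cauchy.
Qed.

(** Makes the [sup] in [opnorm] a genuine supremum rather than a default value. *)
Lemma opnorm_has_ubound m n (M : 'M[R]_(m, n)) :
  has_ubound [set Num.sqrt (nrm2 (M *m v)) | v in [set v : 'cV[R]_n | nrm2 v <= 1]].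
Proof.
have [C C0 hC] := nrm2_mulmx_bounded M.
exists (Num.sqrt C) => _ [v /= v1 <-]; rewrite ler_wsqrtr//.
by apply: le_trans (hC v) _; rewrite ler_piMr.
Qed.

Lemma opnorm_ge0 m n (M : 'M[R]_(m, n)) : 0 <= opnorm M.
Proof.
apply: ub_le_sup; first exact: opnorm_has_ubound.
exists 0; first by rewrite /= nrm2E dotv0.
by rewrite mulmx0 nrm2E dotv0 sqrtr0.
Qed.

Lemma nrm2_mulmx_le m n (M : 'M[R]_(m, n)) v :
  nrm2 (M *m v) <= opnorm M ^+ 2 * nrm2 v.
Proof.
have [->|v0] := eqVneq v 0; first by rewrite mulmx0 !nrm2E !dotv0 mulr0.
have v_gt0 : 0 < nrm2 v by rewrite nrm2_gt0.
set t := (Num.sqrt (nrm2 v))^-1.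
have t2 : t ^+ 2 = (nrm2 v)^-1 by rewrite exprVn sqr_sqrtr// ltW.
have nZ k (w : 'cV[R]_k) : nrm2 (t *: w) = nrm2 w / nrm2 v.
  by rewrite [LHS]nrm2E !dotvS mulrA -expr2 t2 -nrm2E mulrC.
have : Num.sqrt (nrm2 (M *m (t *: v))) <= opnorm M.
  apply: ub_le_sup; first exact: opnorm_has_ubound.
  by exists (t *: v) => //=; rewrite nZ divff// gt_eqF.
rewrite -scalemxAr nZ -ler_sqr ?nnegrE ?opnorm_ge0//.
by rewrite sqr_sqrtr ?ler_pdivrMr// divr_ge0 ?nrm2_ge0.
Qed.

(** For [w = M^T y], |w|^2 = <y, M w> is at most |y| [opnorm M] |w| by Cauchy-Schwarz; squaring and
    dividing by |w|^2 gives the bound. *)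
Lemma nrm2_trmulmx_le m n (M : 'M[R]_(m, n)) y :
  nrm2 (M^T *m y) <= opnorm M ^+ 2 * nrm2 y.
Proof.
set w := M^T *m y.
have [->|w0] := eqVneq w 0.
  by rewrite {1}nrm2E dotv0 mulr_ge0 ?nrm2_ge0 ?sqr_ge0.
have w_gt0 : 0 < nrm2 w by rewrite nrm2_gt0.
rewrite -(ler_pM2r w_gt0) -expr2 {1}nrm2E {1}/w -dotv_mulmx.
apply: le_trans (dotv_cauchy _ _) _.
rewrite [leRHS]mulrAC mulrC ler_wpM2r ?nrm2_ge0//; exact: nrm2_mulmx_le.
Qed.

End InnerProduct.

(** * Pseudoinverses, normal equations and the effect of one projection step *)

Section Pseudoinverse.
Context {R : realType}.

Lemma trmulmx_eq0 m n (X : 'M[R]_(m, n)) : X^T *m X = 0 -> X = 0.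
Proof.
move=> XX; apply/matrixP => i j; rewrite mxE.
have : nrm2 (col j X) == 0.
  have -> : nrm2 (col j X) = (X^T *m X) j j.
    by rewrite nrm2E dotvE mxE; apply: eq_bigr => k _; rewrite !mxE.
  by rewrite XX mxE.
by rewrite nrm2_eq0 => /eqP /colP /(_ i); rewrite !mxE.
Qed.

(** If [X^T X] kills a vector then so does [X], and a left inverse of [X] shows that the vector is
    zero. *)
Lemma trmulmx_unit m n (X : 'M[R]_(m, n)) : row_full X -> X^T *m X \in unitmx.
Proof.
move=> /row_fullP[Y YX]; rewrite -row_free_unit; apply: inj_row_free => v.
rewrite mulmxA => vXX.
have : (X *m v^T)^T *m (X *m v^T) = 0.
  by rewrite trmx_mul trmxK mulmxA vXX mul0mx.
move=> /trmulmx_eq0 Xv; apply: trmx_inj.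
by rewrite -[v^T]mul1mx -YX -mulmxA Xv mulmx0 trmx0.
Qed.

(* Full-rank factorization A = C F gives
   A^+ = F^T (F F^T)^-1 (C^T C)^-1 C^T. *)
Lemma penrose_exists m n (A : 'M[R]_(m, n)) : exists X, penrose A X.
Proof.
move: (row_base A) (col_base A) (mulmx_base A) (row_base_free A)
  (col_base_full A); move: (\rank A) => r F C CF Ffree Cfull.
have CU : C^T *m C \in unitmx by exact: trmulmx_unit.
have FU : F *m F^T \in unitmx.
  by rewrite -{1}[F]trmxK; apply: trmulmx_unit; rewrite /row_full mxrank_tr.
set CI := invmx (C^T *m C); set FI := invmx (F *m F^T).
have CIT : CI^T = CI by rewrite /CI trmx_inv trmx_mul trmxK.
have FIT : FI^T = FI by rewrite /FI trmx_inv trmx_mul trmxK.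
have FV : F *m F^T *m FI = 1%:M by exact: mulmxV.
have CV : CI *m (C^T *m C) = 1%:M by exact: mulVmx.
set X := F^T *m FI *m CI *m C^T.
have AX : A *m X = C *m CI *m C^T.
  rewrite -[A in LHS]CF /X !mulmxA.
  by rewrite -!(mulmxA C) FV mul1mx.
have XA : X *m A = F^T *m FI *m F.
  rewrite -CF /X -!mulmxA (mulmxA C^T) (mulmxA CI).
  by rewrite CV mul1mx.
exists X; split.
- rewrite AX -CF -!mulmxA (mulmxA C^T) (mulmxA CI).
  by rewrite CV mul1mx.
- rewrite XA /X -!mulmxA (mulmxA F F^T) (mulmxA (F *m F^T)) FV.
  by rewrite mul1mx.
- by rewrite AX !trmx_mul trmxK CIT mulmxA.
- by rewrite XA !trmx_mul trmxK FIT mulmxA.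
Qed.

Lemma pinvP m n (A : 'M[R]_(m, n)) : penrose A (Defs.pinv A).
Proof.
rewrite /Defs.pinv; case: pselect => [h|[]]; last exact: penrose_exists.
by case: (cid h).
Qed.

Lemma trmulmx_pinv m n (M : 'M[R]_(m, n)) : M^T *m (M *m Defs.pinv M) = M^T.
Proof.
by have [h _ hT _] := pinvP M; rewrite -hT -trmx_mul h.
Qed.

Lemma mulpinvmx_tr m n (A : 'M[R]_(m, n)) : Defs.pinv A *m A *m A^T = A^T.
Proof. by have [h _ _ hT] := pinvP A; rewrite -hT -trmx_mul mulmxA h. Qed.

(** Solvability of the normal equations: the difference of the two sides kills [M] on the right,
    hence its product with its own transpose is zero. *)
Lemma gram_pinv_tr m n (M : 'M[R]_(m, n)) :
  M^T *m M *m Defs.pinv (M^T *m M) *m M^T = M^T.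
Proof.
have [h _ _ _] := pinvP (M^T *m M).
apply/eqP; rewrite -subr_eq0; apply/eqP/trmx_inj; rewrite trmx0; apply: trmulmx_eq0.
set N := M^T *m M in h *.
have XM : (N *m Defs.pinv N *m M^T - M^T) *m M = 0.
  by rewrite mulmxBl -[X in X - _]mulmxA -/N h subrr.
by rewrite trmxK linearB/= trmx_mul trmxK mulmxBr mulmxA XM mul0mx subrr.
Qed.

Lemma gram_pinv_residual m n (M : 'M[R]_(m, n)) (u : 'cV[R]_m) :
  M^T *m (u - M *m (Defs.pinv (M^T *m M) *m (M^T *m u))) = 0.
Proof. by rewrite mulmxBr !mulmxA gram_pinv_tr subrr. Qed.

Lemma dotv_eq0_residual m n (V : 'M[R]_(m, n)) (u : 'cV[R]_m) s :
  V^T *m u = 0 -> dotv u (V *m s) = 0.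
Proof. by move=> Vu; rewrite dotv_mulmx Vu dot0v. Qed.

(* The step is the best approximation of u in Range (row_mx V d); the bound
   compares it with the point of Range (row_mx V d) nearest to u along the
   component of d orthogonal to Range V. *)
Lemma step_residual_le m n (V : 'M[R]_(m, n)) (dd u : 'cV[R]_m) (g : R) :
  let M := row_mx V dd in
  let e : 'cV[R]_(n + 1) := delta_mx (rshift n (ord0 : 'I_1)) ord0 in
  let p := M *m (Defs.pinv (M^T *m M) *m (g *: e)) in
  V^T *m u = 0 -> dotv dd u = g ->
  M^T *m (u - p) = 0 /\
  (g != 0 -> let w := dd - V *m Defs.pinv V *m dd in
     [/\ nrm2 w = nrm2 dd - nrm2 (V *m Defs.pinv V *m dd), 0 < nrm2 w
       & nrm2 (p - u) <= nrm2 u - g ^+ 2 / nrm2 w]).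
Proof.
move=> M e p Vu ddu.
(* The [V] block of [M^T u] is zero and its last entry is [g], so the system solved by the step is
   the normal equation for projecting [u] onto Range [M]. *)
have ge : g *: e = M^T *m u.
  rewrite tr_row_mx mul_col_mx Vu; apply/colP => i; rewrite !mxE.
  case: splitP => j ij.
    by rewrite !mxE -val_eqE /= ij ltn_eqF ?mulr0// ltn_addr.
  rewrite -val_eqE /= ij !ord1 addn0 eqxx mulr1 -ddu /dotv.
  by rewrite !mxE.
have res : M^T *m (u - p) = 0 by rewrite /p ge gram_pinv_residual.
split=> // g0 w.
have Vw : V^T *m w = 0 by rewrite mulmxBr mulmxA trmulmx_pinv subrr.
have wM : w = M *m col_mx (- (Defs.pinv V *m dd)) 1%:M.
  by rewrite mul_row_col mulmx1 mulmxN mulmxA addrC.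
have dw : dotv w u = g.
  by rewrite dotvC dotvDr dotvNr -mulmxA dotv_eq0_residual// subr0 dotvC.
have w0 : 0 < nrm2 w.
  by rewrite nrm2_gt0; apply: contra_neq g0 => w0; rewrite -dw w0 dot0v.
split=> //.
  have ddE : dd = w + V *m (Defs.pinv V *m dd) by rewrite mulmxA subrK.
  rewrite -mulmxA {1}ddE nrm2D_orth ?addrK//.
  by rewrite dotv_eq0_residual.
(* [t *: w] is the projection of [u] onto the line of [w], whose squared distance to [u] is exactly
   the claimed bound. *)
move: w Vw wM dw w0 => /= w _ wM dw w0; set t := g / nrm2 w.
have -> : nrm2 u - g ^+ 2 / nrm2 w = nrm2 (t *: w - u).
  rewrite [nrm2 (_ - _)]nrm2E !dotvS (dotvC u) dw -!nrm2E /t; field.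
  by rewrite gt_eqF.
(* Pythagoras: [t *: w - p] lies in Range [M], to which [p - u] is orthogonal. *)
have -> : t *: w - u = (p - u) + (t *: w - p) by rewrite [RHS]addrC addrA subrK.
rewrite [leRHS]nrm2D_orth ?lerDl ?nrm2_ge0//.
rewrite -[p - u]opprB dotvNl wM scalemxAr /p -mulmxBr.
by rewrite dotv_eq0_residual ?oppr0.
Qed.

End Pseudoinverse.

(** * Rayleigh quotients and the smallest nonzero singular value *)

Section Rayleigh.
Context {R : realType}.

(** Cauchy-Schwarz for the form [K] at [v] and [K^-1 v] gives |v|^4 <= <v, K v> <K^-1 v, v>, and the
    last factor is at most a multiple of |v|^2. *)
Lemma psd_unit_coercive n (K : 'M[R]_n) : psd K -> K \in unitmx ->
  exists2 c, 0 < c & forall v, c * nrm2 v <= dotv v (K *m v).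
Proof.
move=> Kpsd KU; have [C C0 hC] := nrm2_mulmx_bounded (invmx K).
(* [C + 1] is positive even when [C = 0], and its square dominates [C], which avoids a square root
   in [h2]. *)
exists (C + 1)^-1; first by rewrite invr_gt0; lra.
move=> v; have [->|v0] := eqVneq v 0; first by rewrite !nrm2E mulmx0 !dotv0 mulr0.
have v_gt0 : 0 < nrm2 v by rewrite nrm2_gt0.
have := psd_cauchy v (invmx K *m v) Kpsd.
rewrite !mulmxA mulmxV// !mul1mx -nrm2E => h1.
have q0 : 0 <= dotv v (K *m v) by case: Kpsd => _ /(_ v); rewrite -mulmxA.
have h2 : dotv (invmx K *m v) v <= (C + 1) * nrm2 v.
  rewrite -[leRHS]ger0_norm ?mulr_ge0 ?addr_ge0 ?nrm2_ge0//.
  apply: le_trans (ler_norm _) _; rewrite -ler_sqr ?nnegrE ?normr_ge0//.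
  rewrite !real_normK ?num_real//; apply: le_trans (dotv_cauchy _ _) _.
  rewrite exprMn [nrm2 v ^+ 2]expr2 mulrA ler_wpM2r ?nrm2_ge0//.
  apply: le_trans (hC v) _; rewrite ler_wpM2r ?nrm2_ge0//.
  by rewrite expr2; nra.
rewrite ler_pdivrMl; last by lra.
rewrite -(ler_pM2r v_gt0) -expr2; apply: le_trans h1 _.
by rewrite mulrC mulrAC ler_wpM2r.
Qed.

(* With mu the infimum of the Rayleigh quotient on Range Pi, the operator
   G - mu Pi + (1 - Pi) is psd; were it invertible it would be coercive,
   contradicting the choice of mu, so mu is an eigenvalue of G. *)
Lemma rayleigh_ge n (G Pi : 'M[R]_n) (s : R) : psd G ->
  Pi^T = Pi -> Pi *m Pi = Pi -> G *m Pi = G ->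
  (forall w : 'cV[R]_n, Pi *m w = w -> G *m w = 0 -> w = 0) ->
  (forall l, 0 < l -> eigenvalue G l -> s <= l) ->
  forall u : 'cV[R]_n, Pi *m u = u -> s * nrm2 u <= dotv u (G *m u).
Proof.
move=> Gpsd PiT PiPi GPi Gker sle u Piu.
have [Gsym G0] := Gpsd.
have {}G0 v : 0 <= dotv v (G *m v) by have := G0 v; rewrite -mulmxA.
have PiG : Pi *m G = G by rewrite -{1}Gsym -{1}PiT -trmx_mul GPi.
have [->|u0] := eqVneq u 0; first by rewrite !nrm2E mulmx0 !dotv0 mulr0.
pose E := [set dotv w (G *m w) / nrm2 w | w in [set w : 'cV[R]_n | Pi *m w = w /\ w != 0]].
have E0 : E !=set0 by exists (dotv u (G *m u) / nrm2 u); exists u.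
have Elb0 : lbound E 0.
  by move=> _ [w _ <-]; apply: divr_ge0 => //; exact: nrm2_ge0.
have Elb : has_lbound E by exists 0.
set mu := inf E.
have mu0 : 0 <= mu by apply: lb_le_inf.
have mule w : Pi *m w = w -> mu * nrm2 w <= dotv w (G *m w).
  move=> Piw; have [->|w0] := eqVneq w 0.
    by rewrite !nrm2E mulmx0 !dotv0 mulr0.
  by rewrite -ler_pdivlMr ?nrm2_gt0//; apply: ge_inf => //; exists w.
suff [mugt0 mueig] : 0 < mu /\ eigenvalue G mu.
  apply: le_trans (mule u Piu); rewrite ler_wpM2r ?nrm2_ge0//.
  exact: sle.
pose K := G - mu *: Pi + (1%:M - Pi).
have Kv v : dotv v (K *m v) = dotv (Pi *m v) (G *m (Pi *m v))
                              - mu * nrm2 (Pi *m v) + nrm2 (v - Pi *m v).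
  rewrite /K !(mulmxDl, mulNmx) mul1mx -scalemxAl [nrm2 (v - _)]nrm2E.
  rewrite [G *m (Pi *m v)]mulmxA GPi nrm2E.
  have e1 : dotv (Pi *m v) (Pi *m v) = dotv v (Pi *m v).
    by rewrite -{1}PiT -dotv_mulmx mulmxA PiPi.
  have e2 : dotv (Pi *m v) (G *m v) = dotv v (G *m v).
    by rewrite -{1}PiT -dotv_mulmx mulmxA PiG.
  by rewrite !dotvS e2 e1 (dotvC (Pi *m v) v); ring.
have Kpsd : psd K.
  split; first by rewrite /K !linearD/= !linearN/= linearZ/= trmx1 Gsym PiT.
  move=> v; rewrite -mulmxA -/(dotv _ _) Kv addr_ge0 ?nrm2_ge0// subr_ge0.
  by apply: mule; rewrite mulmxA PiPi.
have [KU|] := boolP (K \in unitmx).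
  have [c c0 hc] := psd_unit_coercive Kpsd KU.
  (* On Range [Pi] the last term of [Kv] vanishes, so coercivity would make [mu + c] a lower bound
     of [E] exceeding its infimum. *)
  suff : mu + c <= mu by rewrite gerDl leNgt c0.
  apply: lb_le_inf => // _ [w [Piw w0] <-].
  rewrite ler_pdivlMr ?nrm2_gt0// mulrDl.
  have := hc w; rewrite Kv Piw subrr [nrm2 0]nrm2E dotv0 addr0.
  by rewrite lerBrDl.
rewrite -row_free_unit -kermx_eq0 => /rowV0Pn[r /sub_kermxP rK r0].
pose v := r^T.
have Kv0 : K *m v = 0.
  by apply: trmx_inj; have [KT _] := Kpsd; rewrite trmx_mul trmxK KT rK trmx0.
(* Applying [1 - Pi] to [K v = 0] kills the [G] and [Pi] terms and leaves [v - Pi v = 0]. *)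
have Piv : Pi *m v = v.
  have := congr1 (mulmx (1%:M - Pi)) Kv0.
  rewrite mulmx0 mulmxA /K !(mulmxDl, mulmxDr, mulNmx, mulmxN, mul1mx, mulmx1).
  rewrite -scalemxAr PiPi PiG !subrr !(add0r, opprK, oppr0, addr0) => /eqP.
  by rewrite addrAC [X in X + (v - _)]addrACA subrr addNr !add0r subr_eq0 => /eqP.
have Gv : G *m v = mu *: v.
  move: Kv0; rewrite /K !(mulmxDl, mulNmx) mul1mx -scalemxAl Piv subrr addr0.
  by move=> /eqP; rewrite subr_eq0 => /eqP.
have v0 : v != 0 by rewrite -(inj_eq (@trmx_inj _ _ _)) trmxK trmx0.
split.
  rewrite lt_def mu0 andbT; apply: contra_neq v0 => m0.
  by apply: Gker => //; rewrite Gv m0 scale0r.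
(* [eigenvalue] is stated with row vectors, hence the return to [r] by symmetry of [G]. *)
apply/eigenvalueP; exists r => //; apply: trmx_inj.
by rewrite trmx_mul Gsym Gv linearZ.
Qed.

Lemma sqr_sigma_min_le m n (B : 'M[R]_(m, n)) l :
  0 < l -> eigenvalue (B^T *m B) l -> sigma_min B ^+ 2 <= l.
Proof.
move=> l0 ll; rewrite /sigma_min; set E := [set _ | _ in _].
have El : E (Num.sqrt l) by exists l.
have E0 : lbound E 0 by move=> _ [x _ <-]; exact: sqrtr_ge0.
rewrite -[leRHS]sqr_sqrtr; last exact: ltW.
rewrite ler_sqr ?nnegrE ?sqrtr_ge0//.
  by apply: ge_inf => //; exists 0.
by apply: lb_le_inf => //; exists (Num.sqrt l).
Qed.

(** Settles the case where [sqrtmx] takes its default value 0: there is no positive eigenvalue, and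
    the infimum of the empty set is 0. *)
Lemma sigma_min0 m n : sigma_min (0 : 'M[R]_(m, n)) = 0.
Proof.
rewrite /sigma_min mulmx0 (_ : [set _ | _ in _] = set0) ?inf0//.
rewrite -subset0 => x [l [l0 /eigenvalueP[v + v0] _]].
rewrite mulmx0 => /esym/eqP; rewrite scaler_eq0 (negbTE v0) orbF.
by rewrite gt_eqF.
Qed.

(** With [B = sqrtmx H *m A] one has [B^T B = A^T H A], and [rayleigh_ge] applies with [Pi = A^+ A],
    the orthogonal projection onto Range [A^T]. *)
Lemma sigma_min_sqrtmx_le m n (H : 'M[R]_m) (A : 'M[R]_(m, n)) (u : 'cV[R]_n) : psd H ->
  (forall w : 'cV[R]_n, dotv (A *m w) (H *m (A *m w)) = 0 -> A *m w = 0) ->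
  Defs.pinv A *m A *m u = u ->
  sigma_min (sqrtmx H *m A) ^+ 2 * nrm2 u <= dotv (A *m u) (H *m (A *m u)).
Proof.
move=> [Hsym Hge0] Hker Pu.
have H0 v : 0 <= dotv v (H *m v) by have := Hge0 v; rewrite -mulmxA.
rewrite /sqrtmx; case: pselect => [h|_]; last first.
  by rewrite mul0mx sigma_min0 expr0n/= mul0r.
case: (cid h) => X [[Xsym _] XX] /=; set B := X *m A.
have BB : B^T *m B = A^T *m H *m A.
  by rewrite trmx_mul Xsym -XX !mulmxA.
have [AXA XAX AXT XAT] := pinvP A.
have GE v : dotv v (B^T *m B *m v) = dotv (A *m v) (H *m (A *m v)).
  by rewrite BB -!mulmxA dotv_mulmx trmxK.
rewrite -GE; apply: (@rayleigh_ge _ _ (Defs.pinv A *m A)) => //.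
- split=> [|v]; first by rewrite trmx_mul trmxK.
  by rewrite -mulmxA -/(dotv _ _) GE.
- by rewrite mulmxA XAX.
- by rewrite BB -!mulmxA (mulmxA A) AXA.
- move=> w Pw Gw.
  by rewrite -Pw -mulmxA Hker ?mulmx0// -GE Gw dotv0.
- exact: sqr_sigma_min_le.
Qed.

End Rayleigh.

(** * Error of one step, orthogonality to the window and invariance of Range [A^T] *)

Section Iteration.
Context {R : realType} (m n q l : nat) (A : 'M[R]_(m, n)) (b : 'cV[R]_m).

Lemma pinv_consistent : (exists x : 'cV[R]_n, A *m x = b) ->
  A *m xstar A b = b.
Proof.
by move=> [x <-]; rewrite /xstar !mulmxA; have [-> _ _ _] := pinvP A.
Qed.

(** Consistency turns the residual into [- A (xs - x)]; this is why the algorithm can form the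
    right-hand side of its projection without knowing [xs]. *)
Lemma dotv_dk (x xs : 'cV[R]_n) (S : 'M[R]_(m, q)) : A *m xs = b ->
  dotv (dk A b x S) (xs - x) = gammak A b x S.
Proof.
move=> Axs; rewrite /dk /gammak dotvNl dotvC dotv_mulmx trmxK.
by rewrite [A *m (xs - x)]mulmxBr Axs -opprB dotvNl opprK dotv_mulmx -nrm2E.
Qed.

Lemma nrm2_dk_le (x : 'cV[R]_n) (S : 'M[R]_(m, q)) :
  nrm2 (dk A b x S) <= opnorm (S^T *m A) ^+ 2 * gammak A b x S.
Proof.
apply: le_trans (nrm2_trmulmx_le _ _).
by rewrite /dk nrm2E dotvNl dotvNr opprK -nrm2E trmx_mul trmxK -!mulmxA.
Qed.

Lemma step_error_le (h : seq 'cV[R]_n) (S : 'M[R]_(m, q)) xs :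
  let xk := nth 0 h (size h).-1 in
  let r := A *m xk - b in
  let rho := (1 - nrm2 (Vk l h *m Defs.pinv (Vk l h) *m dk A b xk S)
                  / nrm2 (dk A b xk S))^-1 in
  A *m xs = b -> (Vk l h)^T *m (xs - xk) = 0 -> S^T *m r != 0 ->
  1 <= rho /\ nrm2 (step l A b h S - xs) <=
    nrm2 (xk - xs) - rho * (((opnorm (S^T *m A)) ^+ 2)^-1 * nrm2 (S^T *m r)).
Proof.
move=> xk r rho Axs Vu Sr.
set dd := dk A b xk S; set g := gammak A b xk S.
have g0 : 0 < g by rewrite nrm2_gt0.
have [_] := step_residual_le Vu (dotv_dk xk S Axs).
case/(_ (lt0r_neq0 g0)); set w := _ - _; set z := _ *m dd => wE w0 le_res.
have d0 : 0 < nrm2 dd by have := nrm2_ge0 z; lra.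
(* The Pythagorean identity [wE] clears the nested quotient in [rho]. *)
have rhoE : rho = nrm2 dd / nrm2 w.
  rewrite /rho -/dd -/z wE; field.
  by rewrite -wE !gt_eqF.
split; first by rewrite rhoE ler_pdivlMr// mul1r wE gerBl nrm2_ge0.
have -> : step l A b h S - xs = step l A b h S - xk - (xs - xk).
  by rewrite opprB addrA subrK.
have -> : nrm2 (xk - xs) = nrm2 (xs - xk).
  by rewrite -opprB nrm2E dotvNl dotvNr opprK -nrm2E.
rewrite {1}/step -/xk [xk + _]addrC addrK.
apply: le_trans le_res _; rewrite lerD2l lerN2 -/g rhoE.
(* A zero norm would force [dd = 0] by [nrm2_dk_le]; so the 0/0 convention does not intervene when
   [S^T r] is nonzero. *)
have op0 : 0 < opnorm (S^T *m A) ^+ 2.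
  rewrite lt_def sqr_ge0 andbT; apply: contraTneq (nrm2_dk_le xk S) => ->.
  by rewrite mul0r -ltNge.
have key := nrm2_dk_le xk S; rewrite -/dd -/g in key.
rewrite mulrAC ler_pM2r ?invr_gt0// mulrA expr2 ler_pM2r//.
by rewrite ler_pdivrMr// mulrC.
Qed.

Variables (x0 : 'cV[R]_n) (Ss : nat -> 'M[R]_(m, q)).
Let x := rim_iter l A b x0 Ss.

Lemma size_hist k : size (hist l A b x0 Ss k) = k.+1.
Proof. by elim: k => //= k IH; rewrite size_rcons IH. Qed.

Lemma nth_hist k j : (j <= k)%N -> nth 0 (hist l A b x0 Ss k) j = x j.
Proof.
elim: k => [|k IH]; first by rewrite leqn0 => /eqP ->.
rewrite leq_eqVlt ltnS => /orP[/eqP->//|jk].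
by rewrite /= nth_rcons size_hist ltnS jk IH.
Qed.

Lemma rim_iterS k : x k.+1 = step l A b (hist l A b x0 Ss k) (Ss k).
Proof. by rewrite /x /rim_iter /= nth_rcons size_hist ltnn eqxx. Qed.

Lemma ncols_hist k : ncols l (hist l A b x0 Ss k) = (k - Defs.jk l k)%N.
Proof. by rewrite /ncols size_hist. Qed.

Lemma window_le k (c : 'I_(ncols l (hist l A b x0 Ss k))) :
  (jk l k + c <= k)%N.
Proof. by case: c => c /=; rewrite ncols_hist; lia. Qed.

Lemma col_Vk_hist k (c : 'I_(ncols l (hist l A b x0 Ss k))) :
  col c (Vk l (hist l A b x0 Ss k)) = x (jk l k + c) - x k.
Proof.
by apply/colP => i; rewrite !mxE size_hist /= !nth_hist// window_le.
Qed.

Lemma trVk_hist_eq0 k (u : 'cV[R]_n) :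
  (forall j, (jk l k <= j <= k)%N -> dotv (x j - x k) u = 0) ->
  (Vk l (hist l A b x0 Ss k))^T *m u = 0.
Proof.
move=> xu; apply/colP => c; rewrite [RHS]mxE.
rewrite -(xu (jk l k + c)%N); last first.
  by rewrite leq_addr window_le.
rewrite -col_Vk_hist dotvE mxE; apply: eq_bigr => i _.
by rewrite !mxE.
Qed.

Lemma Vk_hist_range k j : (jk l k <= j <= k)%N ->
  exists s, x j - x k = Vk l (hist l A b x0 Ss k) *m s.
Proof.
move=> /andP[lj]; rewrite leq_eqVlt => /orP[/eqP->|jk].
  by exists 0; rewrite mulmx0 subrr.
have cP : (j - Defs.jk l k < ncols l (hist l A b x0 Ss k))%N.
  by rewrite ncols_hist; lia.
exists (delta_mx (Ordinal cP) 0).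
by rewrite -colE col_Vk_hist /= subnKC.
Qed.

(* x^k is the projection of xs onto x^(k-1) + Range (M_(k-1)), an affine space
   that contains all the iterates of the k-th window. *)
Lemma rim_iter_orth xs k j : A *m xs = b -> (jk l k <= j <= k)%N ->
  dotv (x j - x k) (xs - x k) = 0.
Proof.
move=> Axs; elim: k j => [|k IH] j.
  by rewrite leqn0 => /andP[_ /eqP->]; rewrite subrr dot0v.
move=> /andP[lj]; rewrite leq_eqVlt ltnS => /orP[/eqP->|jk].
  by rewrite subrr dot0v.
(* The window start is nondecreasing in [k], so an old iterate in the new window was already in the
   previous one. *)
have lj' : (Defs.jk l k <= j <= k)%N by move: lj; rewrite /Defs.jk; lia.
have [s xjE] := Vk_hist_range lj'.
have Vu := trVk_hist_eq0 IH.
have [+ _] := step_residual_le Vu (dotv_dk (x k) (Ss k) Axs).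
set M := row_mx _ _; set p := M *m _ => res.
have xS : x k.+1 = x k + p.
  by rewrite rim_iterS /step size_hist /= nth_hist.
rewrite xS opprD !addrA xjE.
have -> : Vk l (hist l A b x0 Ss k) *m s - p =
          M *m (col_mx s 0 - Defs.pinv (M^T *m M) *m (gammak A b (x k) (Ss k)
            *: delta_mx (rshift _ (ord0 : 'I_1)) ord0)).
  by rewrite mulmxBr mul_row_col mulmx0 addr0.
by rewrite dotvC dotv_eq0_residual.
Qed.

(** [A^+ A] fixes Range [A^T], which contains [x0], every [d_k] and all differences of earlier
    iterates; the induction is strong because a window reaches several iterates back. *)
Lemma rim_iter_range k : (exists y, x0 = A^T *m y) ->
  Defs.pinv A *m A *m x k = x k.
Proof.
move=> [y x0E]; suff : forall j, (j <= k)%N -> Defs.pinv A *m A *m x j = x j.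
  by apply.
elim: k => [|k IH] j.
  by rewrite leqn0 => /eqP->; rewrite /x /rim_iter /= x0E mulmxA mulpinvmx_tr.
rewrite leq_eqVlt ltnS => /orP[/eqP->|]; last exact: IH.
rewrite rim_iterS /step size_hist /= nth_hist//.
rewrite mulmxDr IH// mulmxA mul_mx_row; congr (_ + row_mx _ _ *m _).
  apply/matrixP => i c; have := col_Vk_hist c => /colP xE.
  have xc := IH _ (window_le c).
  transitivity ((Defs.pinv A *m A *m (x (jk l k + c) - x k)) i 0).
    rewrite !mxE; apply: eq_bigr => t _.
    by rewrite -xE [col _ _ _ _]mxE.
  by rewrite mulmxBr xc IH// -xE mxE.
by rewrite /dk mulmxN (mulmxA _ A^T) mulpinvmx_tr.
Qed.

End Iteration.

(** * Integrals of nonnegative functions and of quadratic forms *)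

Section Expectation.
Context {R : realType} {d : measure_display} {T : measurableType d}.
Variable P : probability T R.

(* The error after a step is not known to be measurable in S, which rules out
   ge0_le_integral. *)
Lemma ge0_le_integral_nonmeas (D : set T) (f g : T -> \bar R) :
  (forall x, D x -> 0 <= f x)%E -> (forall x, D x -> f x <= g x)%E ->
  (\int[P]_(x in D) f x <= \int[P]_(x in D) g x)%E.
Proof.
move=> f0 fg; rewrite !ge0_integralE//; last first.
  by move=> x Dx; exact: le_trans (f0 x Dx) (fg x Dx).
apply: le_ereal_sup => _ [h /= hf <-]; exists h => //= x.
apply: le_trans (hf x) _; rewrite /patch.
by case: ifPn => // /set_mem; exact: fg.
Qed.

(** A nonnegative [f] with zero integral vanishes almost everywhere, hence so does [g]. *)
Lemma Rintegral_eq0_sub (f g : T -> R) :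
  P.-integrable setT (EFin \o f) -> P.-integrable setT (EFin \o g) ->
  (forall w, 0 <= f w) -> (forall w, 0 <= g w) ->
  (forall w, f w = 0 -> g w = 0) ->
  Rintegral P setT f = 0 -> Rintegral P setT g = 0.
Proof.
move=> fi gi f0 g0 fg If0.
have Ef : (\int[P]_w `|(EFin \o f) w| = 0)%E.
  under eq_integral do rewrite /= ger0_norm//.
  by rewrite -[LHS]fineK; [rewrite -/(Rintegral P setT f) If0|
    exact: integrable_fin_num].
have mf := measurable_int _ fi; have mg := measurable_int _ gi.
have /(ae_eq_integral_abs P measurableT mf) aef := Ef.
rewrite /Rintegral; suff -> : (\int[P]_w (g w)%:E = 0)%E by [].
transitivity (\int[P]_w `|(EFin \o g) w|)%E.
  by under [RHS]eq_integral do rewrite /= ger0_norm//.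
apply/(ae_eq_integral_abs P measurableT mg).
apply: filterS aef => w /= + _ => /(_ I) [fw0].
by rewrite fg.
Qed.

Lemma Rintegral_support (D : set T) (f : T -> R) :
  (forall w, ~ D w -> f w = 0) -> Rintegral P D f = Rintegral P setT f.
Proof.
move=> f0; rewrite Rintegral_mkcond; apply: eq_Rintegral => w _.
by rewrite /patch; case: ifPn => // /negP wD; rewrite f0// => /mem_set.
Qed.

(** The quadratic form is a finite linear combination of the entries of [F], so entrywise
    integrability and linearity of the integral suffice. *)
Lemma Emx_quad n (F : T -> 'M[R]_n) (v : 'cV[R]_n) : mx_integrable P F ->
  P.-integrable setT (EFin \o (fun w => dotv v (F w *m v))) /\
  dotv v (Emx P F *m v) = Rintegral P setT (fun w => dotv v (F w *m v)).
Proof.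
move=> Fi.
pose f (ij : 'I_n * 'I_n) w :=
  (((v ij.1 0 * v ij.2 0)%:E * (F w ij.1 ij.2)%:E)%E : \bar R).
have quadE (M : 'M[R]_n) : dotv v (M *m v) =
    \sum_(ij : 'I_n * 'I_n) v ij.1 0 * v ij.2 0 * M ij.1 ij.2.
  rewrite dotvE -(pair_bigA _ (fun i j => v i 0 * v j 0 * M i j))/=.
  apply: eq_bigr => i _; rewrite mxE mulr_sumr.
  by apply: eq_bigr => j _; rewrite mulrAC mulrA mulrAC.
have fi ij : P.-integrable setT (f ij) by apply: integrableZl => //; exact: Fi.
have fE : EFin \o (fun w => dotv v (F w *m v)) =
          (fun w => \sum_(ij : 'I_n * 'I_n) f ij w)%E.
  by apply/funext => w /=; rewrite quadE -sumEFin.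
split.
  by rewrite fE; apply: integrable_sum => // ij _; exact: fi.
rewrite quadE; apply: EFin_inj.
rewrite /Rintegral (eq_integral (fun w => \sum_ij f ij w)%E); last first.
  by move=> w _; exact: (congr1 (@^~ w) fE).
rewrite integral_sum//.
rewrite -sumEFin fineK; last first.
  by apply/sum_fin_numP => ij _ _; exact: integrable_fin_num.
apply: eq_bigr => ij _; rewrite /f (integralZl measurableT (Fi _ _)).
rewrite mxE [LHS]EFinM fineK//.
by apply: integrable_fin_num => //; exact: Fi.
Qed.

End Expectation.

(** * Random sketches, the set [Qk] and the conditional expectation *)

Section Sketching.
Context {R : realType} {d : measure_display} {T : measurableType d}.
Variables (P : probability T R) (m n q : nat).
Variables (A : 'M[R]_(m, n)) (S : T -> 'M[R]_(m, q)).
Let Hf := fun w => ((opnorm ((S w)^T *m A)) ^+ 2)^-1 *: (S w *m (S w)^T).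
Let H := Emx P Hf.
Hypothesis SSi : mx_integrable P (fun w => S w *m (S w)^T).
Hypothesis SSpos : posdef (Emx P (fun w => S w *m (S w)^T)).
Hypothesis Hfi : mx_integrable P Hf.

Lemma dotv_gram w (v : 'cV[R]_m) :
  dotv v (S w *m (S w)^T *m v) = nrm2 ((S w)^T *m v).
Proof. by rewrite -mulmxA dotv_mulmx nrm2E. Qed.

Lemma dotv_sketch w (v : 'cV[R]_m) : dotv v (Hf w *m v) =
  ((opnorm ((S w)^T *m A)) ^+ 2)^-1 * nrm2 ((S w)^T *m v).
Proof. by rewrite -scalemxAl dotvZr dotv_gram. Qed.

Lemma dotv_sketch_ge0 w (v : 'cV[R]_m) : 0 <= dotv v (Hf w *m v).
Proof. by rewrite dotv_sketch mulr_ge0 ?nrm2_ge0// invr_ge0 sqr_ge0. Qed.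

Lemma posdef_gram_int (v : 'cV[R]_m) :
  Rintegral P setT (fun w => dotv v (S w *m (S w)^T *m v)) = 0 -> v = 0.
Proof.
have [_ Epos] := SSpos; have [_ <-] := Emx_quad v SSi.
apply: contraPeq => /Epos; rewrite -mulmxA -/(dotv _ _) => h h0.
by rewrite h0 ltxx in h.
Qed.

Lemma sketch_psd : psd H.
Proof.
split=> [|v].
  apply/matrixP => i j; rewrite !mxE; congr (fine _).
  apply: eq_integral => w _; congr (EFin _); rewrite !mxE; congr (_ * _).
  by apply: eq_bigr => k _; rewrite !mxE mulrC.
rewrite -mulmxA -/(dotv _ _); have [_ ->] := Emx_quad v Hfi.
by apply: Rintegral_ge0 => w _; exact: dotv_sketch_ge0.
Qed.

(* On Range A, S^T v = 0 is forced also where S^T A = 0, i.e. where the 0/0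
   convention makes Hf vanish. *)
Lemma sketch_ker (u : 'cV[R]_n) :
  dotv (A *m u) (H *m (A *m u)) = 0 -> A *m u = 0.
Proof.
have [fi ->] := Emx_quad (A *m u) Hfi.
have [gi _] := Emx_quad (A *m u) SSi.
move=> If; apply: posdef_gram_int; move: If.
apply: Rintegral_eq0_sub => // w; first exact: dotv_sketch_ge0.
  by rewrite dotv_gram nrm2_ge0.
rewrite dotv_sketch dotv_gram => /eqP; rewrite mulf_eq0 => /orP[|/eqP//].
rewrite invr_eq0 => /eqP op0; apply/eqP; rewrite eq_le nrm2_ge0 andbT mulmxA.
by apply: le_trans (nrm2_mulmx_le _ _) _; rewrite op0 mul0r.
Qed.

Variable b : 'cV[R]_m.

(** [Qk] is the set where the integrable, hence measurable, function |S^T r|^2 is nonzero. *)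
Lemma Qk_measurable (x : 'cV[R]_n) : measurable (Qk A b S x).
Proof.
have [gi _] := Emx_quad (A *m x - b) SSi.
have /measurable_realfun.measurable_EFinP mg := measurable_int _ gi.
rewrite (_ : Qk A b S x = setT `&`
  (fun w => dotv (A *m x - b) (S w *m (S w)^T *m (A *m x - b))) @^-1` [set~ 0]).
  by apply: mg => //; apply: measurableC; exact: measurable_set1.
rewrite setTI; apply/seteqP; split => w; rewrite /Qk /= dotv_gram.
  by move=> /negP h /eqP; rewrite nrm2_eq0.
by move=> h; apply/negP; rewrite -nrm2_eq0 => /eqP.
Qed.

(** On a null [Qk] the integral of |S^T r|^2 would be zero, and positive definiteness would give
    [r = 0]. Thus [cond_expect] divides by a nonzero number. *)
Lemma Qk_prob_gt0 (x : 'cV[R]_n) : A *m x - b != 0 ->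
  (0 < fine (P (Qk A b S x))).
Proof.
move=> r0; rewrite lt_def fine_ge0// andbT; apply: contra_neq r0 => PQ0.
have [gi _] := Emx_quad (A *m x - b) SSi.
have mQ := Qk_measurable x.
apply: posdef_gram_int.
rewrite -(@Rintegral_support _ _ _ P (Qk A b S x)) => [|w wQ]; last first.
  rewrite dotv_gram; apply/eqP; rewrite nrm2_eq0.
  by apply/negPn/negP.
rewrite /Rintegral null_set_integral//.
  by apply: measurable_int; apply: integrableS gi.
by apply/eqP; rewrite -fine_eq0 ?fin_num_measure// PQ0.
Qed.

Lemma sketch_Qk_int (x : 'cV[R]_n) (r := A *m x - b) :
  Rintegral P (Qk A b S x) (fun w => dotv r (Hf w *m r)) = dotv r (H *m r).
Proof.
have [_ ->] := Emx_quad r Hfi.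
apply: Rintegral_support => w wQ.
rewrite dotv_sketch (_ : (S w)^T *m r = 0) ?nrm2E ?dotv0 ?mulr0//.
exact/eqP/negPn/negP.
Qed.

Lemma cond_expect_le (x : 'cV[R]_n) (f : T -> R) (a c : R) (r := A *m x - b) :
  r != 0 -> 0 <= c -> (forall w, 0 <= f w) ->
  (forall w, Qk A b S x w -> f w <= a - c * dotv r (Hf w *m r)) ->
  (cond_expect P (Qk A b S x) f <= (a - c * dotv r (H *m r))%:E)%E.
Proof.
move=> r0 c0 f0 fle; rewrite /cond_expect.
have p0 := Qk_prob_gt0 r0; have mQ := Qk_measurable x.
have [gi HE] := Emx_quad r Hfi.
have giQ : P.-integrable (Qk A b S x) (EFin \o (fun w => dotv r (Hf w *m r))).
  exact: integrableS gi.
have cgi : P.-integrable (Qk A b S x) (EFin \o (fun w => c * dotv r (Hf w *m r))).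
  by have := integrableZl mQ c giQ; apply: eq_integrable => // w _.
have ai : P.-integrable (Qk A b S x) (EFin \o (fun=> a)).
  exact: finite_measure_integrable_cst.
have int_le : (\int[P]_(w in Qk A b S x) (f w)%:E <=
    (a * fine (P (Qk A b S x)) - c * dotv r (H *m r))%:E)%E.
  apply: (@le_trans _ _ (\int[P]_(w in Qk A b S x)
      (a - c * dotv r (Hf w *m r))%:E)%E).
    by apply: ge0_le_integral_nonmeas => w Qw; rewrite lee_fin ?f0 ?fle.
  rewrite -[leLHS]fineK; last first.
    apply: integrable_fin_num => //.
    by have := integrableB mQ ai cgi; apply: eq_integrable => // w _.
  rewrite lee_fin -/(Rintegral _ _ (fun w => a - c * dotv r (Hf w *m r))).
  by rewrite RintegralB// Rintegral_cst// RintegralZl// sketch_Qk_int.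
apply: le_trans (lee_wpmul2l _ int_le) _; first by rewrite lee_fin invr_ge0 ltW.
rewrite -EFinM lee_fin mulrBr mulrCA mulVf ?gt_eqF// mulr1 lerD2l lerN2.
(* The subtracted term is nonnegative and its factor 1 / P(Qk) is at least 1. *)
rewrite ler_peMl//.
  apply: mulr_ge0 => //; rewrite HE.
  by apply: Rintegral_ge0 => w _; exact: dotv_sketch_ge0.
rewrite invf_ge1// -lee_fin fineK ?fin_num_measure//.
exact: probability_le1.
Qed.

End Sketching.

(** * The contraction estimate in expectation *)

Unset Implicit Arguments.

Theorem theorem3p2 (R : realType) (m n q l : nat)
  (A : 'M[R]_(m, n)) (b : 'cV[R]_m)
  (d : measure_display) (T : measurableType d) (P : probability T R)
  (S : T -> 'M[R]_(m, q)) :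
  (exists x : 'cV[R]_n, A *m x = b) ->
  (forall i j, measurable_fun setT (fun w => S w i j)) ->
  mx_integrable P (fun w => S w *m (S w)^T) ->
  posdef (Emx P (fun w => S w *m (S w)^T)) ->
  let Hf := fun w => ((opnorm ((S w)^T *m A)) ^+ 2)^-1 *: (S w *m (S w)^T) in
  mx_integrable P Hf ->
  let H := Emx P Hf in
  (0 < l)%N ->
  forall (x0 : 'cV[R]_n), (exists y : 'cV[R]_m, x0 = A^T *m y) ->
  forall (omega : nat -> T) (k : nat),
  let Ss := fun j => S (omega j) in
  (forall j, (j < k)%N ->
     (Ss j)^T *m (A *m rim_iter l A b x0 Ss j - b) != 0) ->
  let h := hist l A b x0 Ss k in
  let xk := rim_iter l A b x0 Ss k in
  let xs := xstar A b in
  (cond_expect P (Qk A b S xk)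
     (fun w => nrm2 (step l A b h (S w) - xs))
   <= ((1 - qk l A b S h * (sigma_min (sqrtmx H *m A)) ^+ 2)
        * nrm2 (xk - xs))%:E)%E.
Proof.
move=> Acons _ SSi SSpos Hf Hfi H _ x0 x0E omega k Ss _.
cbv zeta; set h := hist _ _ _ _ _ _; set xk := rim_iter _ _ _ _ _ _.
set xs := xstar A b.
have Axs : A *m xs = b by exact: pinv_consistent.
have xkE : nth 0 h (size h).-1 = xk by rewrite size_hist /= nth_hist.
set r := A *m xk - b.
(* At a solution [Qk] is empty: [qk] is the infimum of the empty set, 0, and the conditional
   expectation is 0 as well. *)
have [r0|r0] := eqVneq r 0.
  have Q0 : Qk A b S xk = set0.
    by rewrite -subset0 => w; rewrite /Qk /= -/r r0 mulmx0 eqxx.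
  have -> : qk l A b S h = 0 by rewrite /qk xkE Q0 image_set0 inf0.
  rewrite Q0 /cond_expect integral_set0 mule0 mul0r subr0 mul1r lee_fin.
  exact: nrm2_ge0.
have Vu : (Vk l h)^T *m (xs - nth 0 h (size h).-1) = 0.
  rewrite xkE; apply: trVk_hist_eq0 => j jk.
  exact: rim_iter_orth.
set V := Vk l h in Vu *.
pose rho w := (1 - nrm2 (V *m Defs.pinv V *m dk A b xk (S w))
                   / nrm2 (dk A b xk (S w)))^-1.
have err w : Qk A b S xk w -> 1 <= rho w /\
    nrm2 (step l A b h (S w) - xs) <= nrm2 (xk - xs) - rho w * dotv r (Hf w *m r).
  by move=> Qw; rewrite dotv_sketch /rho /r -xkE; apply: step_error_le => //; rewrite xkE.
have Q_neq0 : Qk A b S xk !=set0.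
  apply/set0P; apply: contraTneq (Qk_prob_gt0 SSi SSpos r0) => ->.
  by rewrite measure0 ltxx.
have qkE : qk l A b S h = inf [set rho w | w in Qk A b S xk] by rewrite /qk xkE.
have rho_lb : lbound [set rho w | w in Qk A b S xk] 1.
  by move=> _ [w /err[+ _] <-].
have q1 : 1 <= qk l A b S h.
  by rewrite qkE; apply: lb_le_inf => //; case: Q_neq0 => w Qw; exists (rho w), w.
have q0 : 0 <= qk l A b S h by exact: le_trans ler01 q1.
apply: (@le_trans _ _ (nrm2 (xk - xs) - qk l A b S h * dotv r (H *m r))%:E).
  apply: cond_expect_le => // w; first exact: nrm2_ge0.
  move=> Qw; have [_ /le_trans] := err w Qw; apply.
  (* Replacing [rho w] by its infimum is allowed because the form of [Hf] is nonnegative; the lower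
     bound 1 makes that infimum genuine. *)
  rewrite lerD2l lerN2 ler_wpM2r ?dotv_sketch_ge0// qkE.
  by apply: ge_inf; [exists 1|exists w].
rewrite lee_fin mulrBl mul1r lerD2l lerN2 -mulrA ler_wpM2l//.
(* Both [xk] and [xs] are fixed by [A^+ A], so the Rayleigh bound applies to their difference. *)
have -> : r = A *m (xk - xs) by rewrite mulmxBr Axs.
apply: sigma_min_sqrtmx_le; first exact: sketch_psd.
  exact: sketch_ker.
by rewrite mulmxBr rim_iter_range// /xs /xstar mulmxA; have [_ -> _ _] := pinvP A.
Qed.
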